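(* Let $r$ be a function assigning a nonnegative real number to every order-3 tensor over $\mathbb{F}$ (with finite index sets) which is (i) sub-additive for direct sums: if $A\in\mathbb{F}^{\Sigma\times\Sigma\times\Sigma}$ and $B\in\mathbb{F}^{\Sigma'\times\Sigma'\times\Sigma'}$ for disjoint sets $\Sigma,\Sigma'$, then $r(A+B)\le r(A)+r(B)$, where $A+B$ is the tensor over $(\Sigma\cup\Sigma')^3$; and (ii) monotone under identifications: if $B$ is an identification of $A$, then $r(B)\le r(A)$. Suppose $P$ is any promise tensor over $\Sigma\times\Sigma\times\Sigma$ and $I\subset P$ is any problem (not necessarily a permutation problem). Then $\mathrm{cc}(I,P)\ge\log_2\left(\frac{r(I)}{r(P)}\right)$.
   Context: Subsets of $\Sigma^3$ are identified with $\{0,1\}$-valued tensors $\sum_{(a,b,c)\in S}x_ay_bz_c$ over a field $\mathbb{F}$. A zeroing out sets to zero all coefficients outside some $A'\times B'\times C'$. A tensor $B$ is an identification of $A$ if $B$ is obtained from $A$ by first performing a zeroing out and then setting some variables equal to each other (e.g. $x_0y_0z_0+x_0y_1z_1$ is an identification of $x_0y_0z_0+x_1y_1z_1+x_0y_1z_2$ by zeroing out $z_2$ and setting $x_1\leftarrow x_0$). A promise problem $I\subset P\subset\Sigma^3$: players receive $a,b,c$ with $(a,b,c)\in P$ and decide whether $(a,b,c)\in I$. $\mathrm{cc}(I,P)$ is deterministic communication complexity in the shared-blackboard model (players in cyclic order append bits depending on own input and the board, or accept/reject; input accepted iff all accept; correctness required only on $P$; cost = maximum number of bits written). *)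

(* Defs.v *)
From HB Require Import structures.
From mathcomp Require Import all_boot all_order all_algebra.
From mathcomp Require Import all_classical all_reals all_analysis.

Set Implicit Arguments.
Unset Strict Implicit.
Unset Printing Implicit Defensive.

Import Order.TTheory GRing.Theory Num.Theory.
Local Open Scope ring_scope.

(** * Tensors *)

(* [T (x, y, z)] is the coefficient of the monomial x y z; the three families
   of variables may be indexed by different finite sets. *)
Definition tensor (F : fieldType) (X Y Z : finType) := {ffun X * Y * Z -> F}.

Definition tensor_of_set (F : fieldType) (S : finType) (E : {set S * S * S}) :
    tensor F S S S :=
  [ffun t => (t \in E)%:R].

(* The disjoint union of the index sets is the sum type [S + S'], so that
   disjointness needs no hypothesis. *)
Definition direct_sum (F : fieldType) (S S' : finType)
    (A : tensor F S S S) (B : tensor F S' S' S') :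
    tensor F (S + S')%type (S + S')%type (S + S')%type :=
  [ffun t => match t with
             | (inl x, inl y, inl z) => A (x, y, z)
             | (inr x, inr y, inr z) => B (x, y, z)
             | _ => 0
             end].

Definition zero_out (F : fieldType) (X Y Z : finType)
    (X0 : {set X}) (Y0 : {set Y}) (Z0 : {set Z}) (A : tensor F X Y Z) :
    tensor F X Y Z :=
  [ffun t => if [&& t.1.1 \in X0, t.1.2 \in Y0 & t.2 \in Z0] then A t else 0].

(* The substitution x <- f x, y <- g y, z <- h z: two variables become equal
   when they have the same image, and the coefficients of the monomials that
   become equal add up.  The target index sets are arbitrary, so renaming the
   variables, and adding or dropping variables that do not occur, are covered. *)
Definition set_equal (F : fieldType) (X Y Z X' Y' Z' : finType)
    (f : X -> X') (g : Y -> Y') (h : Z -> Z') (A : tensor F X Y Z) :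
    tensor F X' Y' Z' :=
  [ffun t' => \sum_(t : X * Y * Z | (f t.1.1, g t.1.2, h t.2) == t') A t].

Definition identification (F : fieldType) (X Y Z X' Y' Z' : finType)
    (A : tensor F X Y Z) (B : tensor F X' Y' Z') : Prop :=
  exists (X0 : {set X}) (Y0 : {set Y}) (Z0 : {set Z})
         (f : X -> X') (g : Y -> Y') (h : Z -> Z'),
    B = set_equal f g h (zero_out X0 Y0 Z0 A).

(** * Communication complexity *)

(* A node of the tree stands for the content of the board, i.e. for the path
   from the root.  At [Write bit next], the player whose turn it is writes [bit]
   of their own input.  At [Halt d1 d2 d3] the communication is over, and each
   player accepts or rejects according to their own input (and to the board).
   Whether communication is over is thus determined by the board alone: letting
   it depend on a private input would make stopping a third symbol that is not
   counted in the cost. *)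
Inductive protocol (S : Type) : Type :=
| Halt (d1 d2 d3 : S -> bool)
| Write (bit : S -> bool) (next : bool -> protocol S).

(* Input of the player who moves when [k] bits are on the board. *)
Definition turn_input (S : Type) (k : nat) (t : S * S * S) : S :=
  match (k %% 3)%N with
  | 0 => t.1.1
  | 1 => t.1.2
  | _ => t.2
  end.

(* The bits written on input [t], from a board that already holds [k] bits. *)
Fixpoint transcript (S : Type) (k : nat) (p : protocol S) (t : S * S * S) :
    seq bool :=
  match p with
  | Halt _ _ _ => [::]
  | Write bit next =>
      let b := bit (turn_input k t) in b :: transcript k.+1 (next b) t
  end.

Fixpoint accepts (S : Type) (k : nat) (p : protocol S) (t : S * S * S) : bool :=
  match p with
  | Halt d1 d2 d3 => [&& d1 t.1.1, d2 t.1.2 & d3 t.2]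
  | Write bit next => accepts k.+1 (next (bit (turn_input k t))) t
  end.

Definition solves (S : finType) (I P : {set S * S * S}) (p : protocol S) : Prop :=
  forall t, t \in P -> accepts 0 p t = (t \in I).

Definition cost (S : finType) (P : {set S * S * S}) (p : protocol S) : nat :=
  \max_(t in P) size (transcript 0 p t).

Definition achievable (S : finType) (I P : {set S * S * S}) : pred nat :=
  fun n => `[< exists2 p : protocol S, solves I P p & cost P p = n >].

(* Some protocol always exists: every player writes their input in unary. *)
Section Existence.
Variables (S : finType) (I : {set S * S * S}).

Let code_bit (k : nat) (x : S) : bool := enum_rank x == (k %/ 3)%N :> nat.

Let code (k n : nat) (t : S * S * S) : seq bool :=
  [seq code_bit j (turn_input j t) | j <- iota k n].

Let decide (w : seq bool) : bool := [exists u in I, code 0 (#|S| * 3) u == w].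

Let Fixpoint tell_all (n k : nat) (w : seq bool) : protocol S :=
  if n is n'.+1 then Write (code_bit k) (fun b => tell_all n' k.+1 (rcons w b))
  else Halt (fun=> decide w) (fun=> decide w) (fun=> decide w).

Let accepts_tell_all n k w t :
  accepts k (tell_all n k w) t = decide (w ++ code k n t).
Proof.
elim: n k w => [|n IHn] k w /=; first by rewrite cats0 !andbb.
by rewrite IHn cat_rcons.
Qed.

Let code_inj : injective (code 0 (#|S| * 3)).
Proof.
move=> t u eq_code.
have eq_bit (x : S) j : (j < 3)%N ->
    (enum_rank (turn_input j t) == enum_rank x) =
    (enum_rank (turn_input j u) == enum_rank x).
  move=> j3; set k := (enum_rank x * 3 + j)%N.
  have kn : (k < #|S| * 3)%N.
    rewrite /k (@leq_trans ((enum_rank x).+1 * 3)) ?leq_mul2r ?ltn_ord//.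
    by rewrite mulSn addnC ltn_add2r.
  have turnE v : turn_input k v = turn_input j v.
    by rewrite /turn_input /k modnMDl modn_small.
  have := congr1 (nth false ^~ k) eq_code.
  rewrite /code !(nth_map 0) ?size_iota// nth_iota// add0n !turnE.
  by rewrite /code_bit /k divnMDl// divn_small// addn0 -!val_eqE.
have eq_turn j : (j < 3)%N -> turn_input j t = turn_input j u.
  move=> j3; apply: enum_rank_inj; apply/eqP.
  by rewrite eq_bit.
case: t u eq_turn {eq_code eq_bit} => [[a b] c] [[a' b'] c'] eq_turn.
have := eq_turn 0 isT; have := eq_turn 1 isT; have := eq_turn 2 isT.
by rewrite /turn_input /= => -> -> ->.
Qed.

Lemma achievable_ex (P : {set S * S * S}) : exists n, achievable I P n.
Proof.
pose p := tell_all (#|S| * 3) 0 [::].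
exists (cost P p); apply/asboolP; exists p => // t _.
rewrite /p accepts_tell_all /decide cat0s; apply/existsP/idP.
  by case=> u /andP[uI /eqP/code_inj <-].
by move=> tI; exists t; rewrite tI eqxx.
Qed.

End Existence.

Definition cc (S : finType) (I P : {set S * S * S}) : nat :=
  ex_minn (achievable_ex I P).

(* Base 2 logarithm of an extended real, with value -oo at 0.  Extended reals
   make a bound by log2 (x / y) informative when y = 0: then x / y = +oo for
   x > 0, whereas division in [R] would return 0. *)
Definition log2e (R : realType) (x : \bar R) : \bar R :=
  (lne x * ((ln 2)^-1)%:E)%E.

(* Main.v *)
Require Import Defs.
From HB Require Import structures.
From mathcomp Require Import all_boot all_order all_algebra.
From mathcomp Require Import all_classical all_reals all_analysis.

Set Implicit Arguments.
Unset Strict Implicit.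
Unset Printing Implicit Defensive.

Import Order.TTheory GRing.Theory Num.Theory.
Local Open Scope ring_scope.

(** If the board says which of two classes an input is in, both [I] and [P] split
accordingly.  The tensor of [I] is an identification of the direct sum of its
two parts (fold [S + S] onto [S]), whereas each part of [P] is a zeroing out of
[P].  Hence every bit on the board costs at most a factor of 2 in [r I / r P],
and when communication is over, [I] itself is a zeroing out of [P]. *)

Section Identifications.
Variable F : fieldType.

Lemma set_equal_id (X Y Z : finType) (A : tensor F X Y Z) :
  set_equal id id id A = A.
Proof.
by apply/ffunP => t; rewrite ffunE (big_pred1 t)// => -[[x y] z].
Qed.

Lemma zero_outT (X Y Z : finType) (A : tensor F X Y Z) :
  zero_out finset.setT finset.setT finset.setT A = A.
Proof. by apply/ffunP => t; rewrite ffunE !inE. Qed.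

(** A pure zeroing out: the variables satisfying [a], [b], [c] are kept and no two variables are
    merged. *)
Lemma identification_box (S : finType) (a b c : pred S)
    (E : {set S * S * S}) :
  identification (tensor_of_set F E)
    (tensor_of_set F [set t in E | [&& a t.1.1, b t.1.2 & c t.2]]).
Proof.
exists [set x | a x], [set x | b x], [set x | c x], id, id, id.
rewrite set_equal_id; apply/ffunP => t; rewrite !ffunE !inE.
by case: ifP; rewrite (andbT, andbF).
Qed.

Lemma identification_direct_sum (S : finType) (A B : tensor F S S S) :
  identification (direct_sum A B) [ffun t => A t + B t].
Proof.
pose fold (u : S + S) : S := match u with inl x => x | inr x => x end.
exists finset.setT, finset.setT, finset.setT, fold, fold, fold; rewrite zero_outT.
apply/ffunP => -[[x y] z]; rewrite !ffunE.
rewrite (bigD1 (inl x, inl y, inl z))//= (bigD1 (inr x, inr y, inr z)) ?eqxx//=.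
(* The all-left and all-right preimages have been split off; mixed triples have coefficient 0 in the
   direct sum. *)
rewrite !ffunE big1 ?addr0// => -[[[u|u] [v|v]] [w|w]] /=; rewrite ffunE//.
  by case/andP=> /andP[/eqP[-> -> ->]]; rewrite eqxx.
by case/andP=> /andP[/eqP[-> -> ->]]; rewrite eqxx.
Qed.

End Identifications.

Section Bound.
Variables (R : realType) (F : fieldType).
Variable r : forall X Y Z : finType, tensor F X Y Z -> R.
Hypothesis r_ge0 : forall (X Y Z : finType) (A : tensor F X Y Z), 0 <= r A.
Hypothesis r_subadditive : forall (S S' : finType)
    (A : tensor F S S S) (B : tensor F S' S' S'),
  r (direct_sum A B) <= r A + r B.
Hypothesis r_monotone : forall (X Y Z X' Y' Z' : finType)
    (A : tensor F X Y Z) (B : tensor F X' Y' Z'),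
  identification A B -> r B <= r A.
Variable S : finType.
Implicit Types (I P E : {set S * S * S}) (p : protocol S).

Let rs E := r (tensor_of_set F E).

(** The two parts are disjoint, so their tensors add up entrywise to that of [E]. Here [D] may be
    any predicate, not only a box. *)
Lemma rank_split (D : pred (S * S * S)) E :
  rs E <= rs [set t in E | D t] + rs [set t in E | ~~ D t].
Proof.
apply: le_trans (r_subadditive _ _); apply: r_monotone.
rewrite [X in identification _ X](_ : _ = [ffun t =>
    tensor_of_set F [set t in E | D t] t +
    tensor_of_set F [set t in E | ~~ D t] t]).
  exact: identification_direct_sum.
apply/ffunP => t; rewrite !ffunE !inE.
by case: (t \in E); case: (D t); rewrite /= ?addr0 ?add0r.
Qed.

(** The condition constrains a single coordinate, so it cuts out a box that is full in the other
    two. *)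
Lemma rank_turn_input (k : nat) (d : pred S) E :
  rs [set t in E | d (turn_input k t)] <= rs E.
Proof.
apply: r_monotone; rewrite /turn_input; case: (k %% 3)%N => [|[|m]].
- have := identification_box F d predT predT E.
  by under eq_finset do rewrite !andbT.
- have := identification_box F predT d predT E.
  by under eq_finset do rewrite !andbT.
- exact: (identification_box F predT predT d E).
Qed.

(** Induction on the protocol tree. Writing a bit shifts the turn [k], lowers the budget [n] and
    shrinks both [I] and [P], so all four are generalized. *)
Lemma rank_le_protocol p k n I P : I \subset P ->
  {in P, forall t, accepts k p t = (t \in I)} ->
  {in P, forall t, size (transcript k p t) <= n}%N ->
  rs I <= 2 ^+ n * rs P.
Proof.
have pow_ge1 m E : rs E <= 2 ^+ m * rs E.
  by rewrite ler_peMl ?r_ge0// exprn_ege1// ler1n.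
elim: p k n I P => [d1 d2 d3|bit next IHp] k n I P subIP accP sizeP.
  apply: le_trans (pow_ge1 n P); apply: r_monotone.
  rewrite (_ : I = [set t in P | [&& d1 t.1.1, d2 t.1.2 & d3 t.2]]).
    exact: identification_box.
  apply/setP => t; rewrite inE; case: (boolP (t \in P)) => [tP|].
    by rewrite -accP.
  by apply: contraNF => /=; apply: (fintype.subsetP subIP).
case: n sizeP => [|n] sizeP.
  (* A [Write] node puts a bit on the board for every input, so budget 0 forces [P], and hence [I],
     to be empty. *)
  have P0 : P = finset.set0 by apply/setP => t; rewrite inE; apply/negP => /sizeP.
  by move: subIP; rewrite P0 finset.subset0 => /eqP->; rewrite expr0 mul1r.
(* On the inputs where [b] is written, the subtree [next b] decides the restricted problem with
   budget [n]. *)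
have half (b : bool) (D := fun t => bit (turn_input k t) == b) :
    rs [set t in I | D t] <= 2 ^+ n * rs P.
  apply: (@le_trans _ _ (2 ^+ n * rs [set t in P | D t])); last first.
    rewrite ler_pM2l ?exprn_gt0//.
    exact: (rank_turn_input k (fun x => bit x == b)).
  apply: (IHp b k.+1).
  - apply/fintype.subsetP => t.
    by rewrite !inE => /andP[/(fintype.subsetP subIP)->].
  - move=> t; rewrite !inE /D => /andP[/accP /= <- /eqP bitE].
    by rewrite bitE eqxx andbT.
  - by move=> t; rewrite inE => /andP[/sizeP /= tP /eqP <-].
apply: le_trans (rank_split (fun t => bit (turn_input k t) == true) I) _.
rewrite exprS -mulrA mulr2n mulrDl !mul1r lerD// ?half//.
have := half false; congr (rs _ <= _).
by apply/setP => t; rewrite !inE; case: (bit _).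
Qed.

(** The minimum defining [cc] is attained by a protocol, whose cost bounds every transcript on
    [P]. *)
Lemma rank_le_cc I P : I \subset P -> rs I <= 2 ^+ cc I P * rs P.
Proof.
move=> subIP; rewrite /cc; case: ex_minnP => n /asboolP[p solp <-] _.
apply: (rank_le_protocol (p := p) (k := 0)) => // t tP.
exact: leq_bigmax_cond.
Qed.

End Bound.

(** If [x] is 0 the quotient is 0, even for [y] equal to 0, and its logarithm is -oo. Otherwise [x]
    is positive, which forces [y] to be positive, and the real logarithm applies. *)
Lemma log2e_div_le (R : realType) (x y : R) (n : nat) :
  0 <= x -> 0 <= y -> x <= 2 ^+ n * y ->
  (log2e (x%:E / y%:E) <= n%:R%:E)%E.
Proof.
move=> x0 y0 xy; have ln2_gt0 : 0 < ln (2 : R) by rewrite ln_gt0// ltr1n.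
have log0 : (log2e 0 <= n%:R%:E :> \bar R)%E.
  by rewrite /log2e le0_lneNy// gt0_mulNye ?lte_fin ?invr_gt0// leNye.
have [->|xneq0] := eqVneq x 0; first by rewrite mul0e.
have x_gt0 : 0 < x by rewrite lt_def xneq0.
have y_gt0 : 0 < y.
  by have := lt_le_trans x_gt0 xy; rewrite pmulr_rgt0// exprn_gt0.
rewrite inver gt_eqF// -EFinM /log2e lne_EFin ?divr_gt0// -EFinM lee_fin.
rewrite ler_pdivrMr// mulr_natl -lnXn// ler_ln ?posrE ?divr_gt0 ?exprn_gt0//.
by rewrite ler_pdivrMr.
Qed.

Theorem mainTheorem15 (R : realType) (F : fieldType)
    (r : forall X Y Z : finType, tensor F X Y Z -> R)
    (r_ge0 : forall (X Y Z : finType) (A : tensor F X Y Z), 0 <= r X Y Z A)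
    (r_subadditive : forall (S S' : finType)
        (A : tensor F S S S) (B : tensor F S' S' S'),
      r _ _ _ (direct_sum A B) <= r _ _ _ A + r _ _ _ B)
    (r_monotone : forall (X Y Z X' Y' Z' : finType)
        (A : tensor F X Y Z) (B : tensor F X' Y' Z'),
      identification A B -> r _ _ _ B <= r _ _ _ A)
    (S : finType) (I P : {set S * S * S}) (subIP : I \subset P) :
  (log2e ((r _ _ _ (tensor_of_set F I))%:E / (r _ _ _ (tensor_of_set F P))%:E)
    <= (cc I P)%:R%:E)%E.
Proof.
apply: log2e_div_le => //.
exact: (rank_le_cc r_ge0 r_subadditive r_monotone).
Qed.
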